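(* Let $T\colon c\to c$ be the Cesàro operator, let $X=\{x\in c:(T^nx)_{n\ge0}\text{ converges in norm as }n\to\infty\}$, and let $X_\infty$ be the set of all $x\in X$ such that $\|T^nx-Px\|_\infty=O(n^{-r})$ as $n\to\infty$ for every $r>0$. Then $X_\infty$ is a dense subspace of $X$.
   Context: $c$ denotes the complex Banach space of convergent complex sequences $x=(x_k)_{k\ge0}$, endowed with the supremum norm $\|\cdot\|_\infty$; density in $X$ is with respect to this norm, and subspace means linear subspace. The Cesàro operator $T\colon c\to c$ is the bounded linear operator given by $(Tx)_k=\frac{1}{k+1}\sum_{j=0}^k x_j$ for $k\ge0$. The operator $P\colon c\to c$ is defined by $Px=x_0e_\infty$, where $e_\infty=(1,1,1,\dots)$. *)

(* Defs.v *)
From HB Require Import structures.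
From mathcomp Require Import all_boot all_order all_algebra.
From mathcomp Require Import all_classical all_reals all_analysis.
From mathcomp Require Import complex.

Set Implicit Arguments.
Unset Strict Implicit.
Unset Printing Implicit Defensive.

Import Order.TTheory GRing.Theory Num.Theory.
Import numFieldNormedType.Exports Normc.

Local Open Scope classical_set_scope.
Local Open Scope ring_scope.
Local Open Scope complex_scope.

Lemma is_cvg_linear (K : numFieldType) (a : K) (x y : nat -> K) :
  cvgn x -> cvgn y -> cvgn (a *: x + y).
Proof. by move=> cx cy; apply: is_cvgD => //; exact: is_cvgZl_tmp. Qed.

Lemma cvgn_bounded (K : numFieldType) (x : nat -> K) : cvgn x ->
  exists M, forall k, `|x k| <= M.
Proof.
by move=> /cvg_seq_bounded/pinfty_ex_gt0[M M_gt0 /= xM]; exists M => k; exact: xM.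
Qed.

Section Complex.
Variable R : realType.

(* The usual topology and norm of the complex numbers, seen as a normed space
   over themselves. *)
HB.instance Definition _ := GRing.ComAlgebra.copy R[i] R[i]^o.
HB.instance Definition _ := NormedModule.copy R[i] R[i]^o.

Lemma normcE (z : R[i]) : `|z| = (normc z)%:C.
Proof. by []. Qed.

Lemma normc_ge0 (z : R[i]) : 0 <= normc z.
Proof. by case: z => a b; exact: sqrtr_ge0. Qed.

Lemma normcD (z w : R[i]) : normc (z + w) <= normc z + normc w.
Proof. by rewrite -lecR rmorphD/= -!normcE ler_normD. Qed.

Lemma cvg_normc (x : nat -> R[i]) (l : R[i]) :
  x @ \oo --> l <-> (fun k => normc (x k - l)) @ \oo --> (0 : R).
Proof.
split=> [/cvgrPdist_lt xl|/cvgrPdist_lt xl]; apply/cvgrPdist_lt => e e0.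
  have : (0 : R[i]) < e%:C by rewrite ltcR.
  move/xl; apply: filterS => k.
  by rewrite distrC normcE ltcR sub0r normrN ger0_norm ?normc_ge0.
have [eE re0] : e = (complex.Re e)%:C /\ 0 < complex.Re e.
  by case: e e0 => a b; rewrite ltcE/= => /andP[/eqP -> ->].
move: re0 => /xl; apply: filterS => k.
by rewrite sub0r normrN ger0_norm ?normc_ge0// distrC normcE eE ltcR.
Qed.

End Complex.

Section SpaceC.
Variable R : realType.

Definition convergent : {pred nat -> R[i]} := fun x => `[< cvgn x >].

Lemma convergentP (x : nat -> R[i]) : reflect (cvgn x) (x \in convergent).
Proof. exact: asboolP. Qed.

Lemma convergent_submod : submod_closed convergent.
Proof.
split; first by apply/convergentP; exact: is_cvg_cst.
move=> a x y /convergentP cx /convergentP cy; apply/convergentP.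
exact: (is_cvg_linear cx cy).
Qed.

HB.instance Definition _ :=
  GRing.isSubmodClosed.Build _ (nat -> R[i]) convergent convergent_submod.

Record cspace := CSpace {
  cspace_val :> nat -> R[i];
  _ : cspace_val \in convergent }.

HB.instance Definition _ := [isSub for cspace_val].
HB.instance Definition _ := [Choice of cspace by <:].
HB.instance Definition _ := [SubChoice_isSubLmodule of cspace by <:].

Lemma cspace_cvg (x : cspace) : cvgn x.
Proof. exact/convergentP/(valP x). Qed.

Definition supnorm (x : cspace) : R := sup (range (fun k => normc (x k))).

Lemma supnorm_has_sup (x : cspace) : has_sup (range (fun k => normc (x k))).
Proof.
split; first by exists (normc (x 0%N)), 0%N.
have [M xM] := cvgn_bounded (@cspace_cvg x).
exists (complex.Re M) => _ [k _ <-].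
by have := xM k; rewrite normcE lecE => /andP[].
Qed.

Lemma supnorm_ub (x : cspace) k : normc (x k) <= supnorm x.
Proof. by apply: ub_le_sup; [exact: (supnorm_has_sup x).2 | exists k]. Qed.

Lemma supnorm_le (x : cspace) (M : R) :
  (forall k, normc (x k) <= M) -> supnorm x <= M.
Proof.
by move=> xM; apply: ge_sup => [|_ [k _ <-]//]; exists (normc (x 0%N)), 0%N.
Qed.

Lemma supnorm_ge0 (x : cspace) : 0 <= supnorm x.
Proof. exact: le_trans (normc_ge0 _) (supnorm_ub x 0%N). Qed.

Lemma supnormD (x y : cspace) :
  (supnorm (x + y))%:C <= (supnorm x)%:C + (supnorm y)%:C.
Proof.
rewrite -rmorphD lecR; apply: supnorm_le => k.
by apply: le_trans (normcD _ _) _; rewrite lerD// supnorm_ub.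
Qed.

Lemma supnormZ (a : R[i]) (x : cspace) :
  (supnorm (a *: x))%:C = `|a| * (supnorm x)%:C.
Proof.
rewrite normcE -rmorphM; congr (_%:C); apply/eqP; rewrite eq_le.
apply/andP; split.
  apply: supnorm_le => k; rewrite [normc _]normcM.
  by rewrite ler_wpM2l ?normc_ge0 ?supnorm_ub.
have [->|a0] := eqVneq a 0; first by rewrite normc0 mul0r supnorm_ge0.
have na0 : 0 < normc a.
  rewrite lt_neqAle normc_ge0 andbT eq_sym.
  by apply: contra a0 => /eqP/eq0_normc ->.
rewrite mulrC -ler_pdivlMr//; apply: supnorm_le => k.
by rewrite ler_pdivlMr// mulrC -normcM; exact: (supnorm_ub (a *: x) k).
Qed.

Lemma supnorm0_eq0 (x : cspace) : (supnorm x)%:C = 0 -> x = 0.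
Proof.
move=> /complexI x0; apply/val_inj/funext => k.
by apply/eq0_normc/le_anti; rewrite normc_ge0 -x0 supnorm_ub.
Qed.

(* Norms of complex normed spaces take their values in [R[i]]; this one is
   the real number [supnorm x]. *)
HB.instance Definition _ :=
  Lmodule_isNormed.Build R[i] cspace supnormD supnormZ supnorm0_eq0.

Lemma cspace_normE (x : cspace) : `|x| = (supnorm x)%:C.
Proof. by []. Qed.

Definition cesaro_mean (x : nat -> R[i]) (k : nat) : R[i] :=
  k.+1%:R^-1 * \sum_(0 <= j < k.+1) x j.

Lemma normc_sum (I : Type) (r : seq I) (F : I -> R[i]) :
  normc (\sum_(i <- r) F i) <= \sum_(i <- r) normc (F i).
Proof.
elim/big_ind2 : _ => [|u p v q up vq|//]; first by rewrite normc0.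
by apply: le_trans (lerD up vq); exact: normcD.
Qed.

Lemma cesaro_mean_convergent (x : cspace) : cesaro_mean x \in convergent.
Proof.
have /cvg_ex[l /cvg_normc xl] := @cspace_cvg x; apply/convergentP/cvg_ex.
exists l; apply/cvg_normc.
apply: (@squeeze_cvgr _ _ _ _ (cst (0 : R))
  (arithmetic_mean (fun k => normc (x k - l)))); last 2 first.
- exact: cvg_cst.
- exact: cesaro xl.
apply: nearW => k; rewrite normc_ge0/= /arithmetic_mean/= seriesEnat/=.
have -> : cesaro_mean x k - l = k.+1%:R^-1 * \sum_(0 <= j < k.+1) (x j - l).
  by rewrite sumrB sumr_const_nat subn0 mulrBr -[l *+ _]mulr_natl mulKf.
have normc_nat n : normc (n%:R : R[i]) = n%:R.
  by apply: complexI; rewrite -normcE normr_nat rmorph_nat.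
by rewrite normcM normcV normc_nat ler_wpM2l ?invr_ge0 ?normc_sum.
Qed.

Definition cesaroT (x : cspace) : cspace := CSpace (cesaro_mean_convergent x).

Lemma cst_convergent (a : R[i]) : (fun=> a) \in convergent.
Proof. by apply/convergentP; exact: is_cvg_cst. Qed.

Definition einf : cspace := CSpace (cst_convergent 1).

Definition cesaroP (x : cspace) : cspace := x 0%N *: einf.

Definition cesaroX : set cspace := [set x | cvgn (fun n => iter n cesaroT x)].

(* Only large [n] matter in [=O_\oo], so the value of the power at [n = 0] is
   irrelevant. *)
Definition cesaroXinf : set cspace :=
  [set x | cesaroX x /\ forall r : R, 0 < r ->
     (fun n => iter n cesaroT x - cesaroP x) =O_\oo
     (fun n => (n%:R `^ (- r))%:C : R[i])].

End SpaceC.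

(* Main.v *)
(* If [T^n x] converges, its limit is a fixed point of [T], hence the constant
   sequence [P x], so that [y = x - P x] satisfies [T^n y -> 0]. The elements
   [(I - T^N) y] are then close to [y] for large [N], and so is the infinite
   product [z = lim_j (I - T^(N_0)) ... (I - T^(N_j)) y] when the [N_j] grow fast
   enough. Since [I - T] divides each factor, [z] decays like
   [T^n (I - T)^m] for every [m], and it suffices that
   [||T^n (I - T)|| = O(n^(-1/2))].

   That bound comes from a factorization [2 T = S (I + T)] with [S] a weighted
   mean, hence a contraction: it gives
   [2^n ||T^n w|| <= ||(I + T)^n w||], and the coefficients of [(I + T)^n (I - T)]
   are [C(n+1, i) (n + 1 - 2 i) / (n + 1)], whose absolute values sum to at most
   [2^(n+1) / sqrt (n + 1)] by the variance of the binomial law. *)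

Require Import Defs.
From HB Require Import structures.
From mathcomp Require Import all_boot all_order all_algebra.
From mathcomp Require Import all_classical all_reals all_analysis.
From mathcomp Require Import complex.
From mathcomp Require Import zify ring lra.

Set Implicit Arguments.
Unset Strict Implicit.
Unset Printing Implicit Defensive.

Import Order.TTheory GRing.Theory Num.Theory.
Import numFieldNormedType.Exports Normc.

Local Open Scope classical_set_scope.
Local Open Scope ring_scope.

(** * Moments of the binomial law *)

Section BinomialSums.

Lemma sum_binS (V : zmodType) (f : nat -> V) n :
  \sum_(i < n.+2) f i *+ 'C(n.+1, i)
  = \sum_(i < n.+1) (f i + f i.+1) *+ 'C(n, i).
Proof.
under [RHS]eq_bigr do rewrite mulrnDl.
rewrite big_split/= big_ord_recl bin0.
under [X in _ + X = _]eq_bigr do rewrite lift0 binS mulrnDr.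
rewrite big_split/= addrA; congr (_ + _).
by rewrite big_ord_recr/= bin_small// mulr0n addr0 [RHS]big_ord_recl bin0.
Qed.

(** The coefficient of [f i] on the left is [C(n, i) - C(n, i - 1)] times [n + 1]; the absorption
    identities [mul_bin_down] and [mul_bin_diag] rewrite its two halves. The factor [n + 1] clears
    denominators. *)
Lemma sum_bin_diff (V : zmodType) (f : nat -> V) n :
  (\sum_(i < n.+1) (f i - f i.+1) *+ 'C(n, i)) *+ n.+1
  = \sum_(i < n.+2) (f i *+ ((n.+1 - i) * 'C(n.+1, i)) - f i *+ (i * 'C(n.+1, i))).
Proof.
rewrite sumrB [X in _ = X - _]big_ord_recr/= subnn mul0n mulr0n addr0.
rewrite [X in _ = _ - X]big_ord_recl/= mul0n mulr0n add0r -sumrB -sumrMnl.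
apply: eq_bigr => i _.
by rewrite /bump/= add1n -mul_bin_down -mul_bin_diag -mulrnA mulnC mulrnBl.
Qed.

(** Pascal's rule produces the sums at [a] and at [a - 2], so the induction keeps [a] free. At
    [a = n] this is the variance of [n - 2 i]. *)
Lemma binomial_second_moment (K : comPzRingType) (a : K) n :
  \sum_(i < n.+1) (a - i%:R *+ 2) ^+ 2 *+ 'C(n, i)
  = ((a - n%:R) ^+ 2 + n%:R) *+ 2 ^ n.
Proof.
elim: n a => [|n IHn] a; first by rewrite big_ord1/= bin0 expn0 !mulr0n mul0rn addr0.
rewrite (sum_binS (fun i => (a - i%:R *+ 2) ^+ 2)).
under eq_bigr do rewrite mulrnDl.
rewrite big_split/= IHn.
have -> : \sum_(i < n.+1) (a - i.+1%:R *+ 2) ^+ 2 *+ 'C(n, i)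
    = \sum_(i < n.+1) ((a - 2) - i%:R *+ 2) ^+ 2 *+ 'C(n, i).
  by apply: eq_bigr => i _; congr (_ ^+ 2 *+ _); ring.
rewrite IHn -mulrnDl expnS mulrnA; congr (_ *+ _).
by rewrite -natr1; ring.
Qed.

(** A mean is at most the root of the second moment, here [n]. The case [n = 0] is apart because the
    estimate is divided by [s]. *)
Lemma binomial_first_moment (R : rcfType) n :
  \sum_(i < n.+1) `|n%:R - i%:R *+ 2 : R| *+ 'C(n, i)
  <= Num.sqrt n%:R *+ 2 ^ n.
Proof.
case: n => [|n]; first by rewrite big_ord1/= !mulr0n mul0rn subr0 normr0 sqrtr0 !mul0rn.
set s := Num.sqrt _.
have s0 : 0 < s by rewrite sqrtr_gt0 ltr0n.
have ss : s * s = n.+1%:R by rewrite -expr2 sqr_sqrtr// ler0n.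
rewrite -(ler_pM2l (mulr_gt0 s0 (ltr0n R 2))) mulr_sumr.
(* AM-GM: [2 s |d| <= d^2 + s^2] *)
apply: (@le_trans _ _ (\sum_(i < n.+2)
    ((n.+1%:R - i%:R *+ 2 : R) ^+ 2 + n.+1%:R) *+ 'C(n.+1, i))).
  apply: ler_sum => i _; rewrite -[X in _ * X <= _]mulr_natr -[leRHS]mulr_natr.
  rewrite mulrA ler_wpM2r ?ler0n//.
  set d := n.+1%:R - _; rewrite -[X in _ <= X + _]real_normK ?num_real//.
  by rewrite -ss; have := sqr_ge0 (`|d| - s); lra.
under eq_bigr do rewrite mulrnDl.
rewrite big_split/= binomial_second_moment subrr expr0n/= add0r.
have -> : \sum_(i < n.+2) (n.+1%:R : R) *+ 'C(n.+1, i) = n.+1%:R *+ 2 ^ n.+1.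
  rewrite sumrMnr; congr (_ *+ _).
  have := expnDn 1 1 n.+1; rewrite addn1 => ->.
  by apply: eq_bigr => i _; rewrite !exp1n !muln1.
rewrite -mulrnDl -[leLHS]mulr_natr -[X in _ <= _ * X]mulr_natr mulrA.
by rewrite ler_wpM2r ?ler0n// -ss; lra.
Qed.

End BinomialSums.

(** * Powers of the Cesàro operator [T] and the decay of [T^n (I - T)] *)

Section CesaroPowers.
Variable R : realType.
Implicit Types (x y v w : cspace R) (n k : nat).

Lemma normc_nat n : normc (n%:R : R[i]) = n%:R.
Proof. by apply: complexI; rewrite -Defs.normcE normr_nat rmorph_nat. Qed.

Lemma ler_supnormD x y : supnorm (x + y) <= supnorm x + supnorm y.
Proof. by rewrite -lecR rmorphD; exact: supnormD. Qed.

Lemma supnormN x : supnorm (- x) = supnorm x.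
Proof. by apply: complexI; rewrite -!cspace_normE normrN. Qed.

Lemma supnorm0 : supnorm (0 : cspace R) = 0.
Proof. by apply: complexI; rewrite -cspace_normE normr0. Qed.

Lemma supnormMn x n : supnorm (x *+ n) = supnorm x *+ n.
Proof. by apply: complexI; rewrite rmorphMn -!cspace_normE normrMn. Qed.

Lemma supnorm_distMn x m n :
  supnorm (x *+ m - x *+ n) = supnorm x * `|m%:R - n%:R|.
Proof.
wlog le_nm : m n / (n <= m)%N.
  move=> wlog_le; case: (leqP n m) => [|/ltnW] le_; first exact: wlog_le.
  by rewrite -supnormN opprB distrC wlog_le.
by rewrite -mulrnBr// -natrB// normr_nat supnormMn mulr_natr.
Qed.

Lemma ler_supnorm_sum (I : Type) (r : seq I) (F : I -> cspace R) :
  supnorm (\sum_(i <- r) F i) <= \sum_(i <- r) supnorm (F i).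
Proof.
elim/big_ind2 : _ => [|u p v q up vq|//]; first by rewrite supnorm0.
by apply: le_trans (lerD up vq); exact: ler_supnormD.
Qed.

Lemma cesaroT_linear : linear (@cesaroT R).
Proof.
move=> a x y; apply/val_inj/funext => k.
rewrite -[LHS]/(cesaro_mean (fun j => a * x j + y j) k).
rewrite -[RHS]/(a * cesaro_mean x k + cesaro_mean y k) /cesaro_mean.
by rewrite big_split/= -mulr_sumr; ring.
Qed.

HB.instance Definition _ :=
  GRing.isLinear.Build R[i] (cspace R) (cspace R) _ (@cesaroT R) cesaroT_linear.

Definition cesaro_iter n x := iter n (@cesaroT R) x.

Lemma cesaro_iter_linear n : linear (cesaro_iter n).
Proof.
by elim: n => [|n IHn] a x y //; rewrite /cesaro_iter/= -!/(cesaro_iter n _) IHn linearP.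
Qed.

HB.instance Definition _ n :=
  GRing.isLinear.Build R[i] (cspace R) (cspace R) _ (cesaro_iter n)
    (cesaro_iter_linear n).

Lemma cesaro_iterD m n x :
  cesaro_iter (m + n) x = cesaro_iter m (cesaro_iter n x).
Proof. exact: iterD. Qed.

Lemma supnorm_cesaroT x : supnorm (cesaroT x) <= supnorm x.
Proof.
apply: supnorm_le => k; rewrite [X in normc X]/= /cesaro_mean.
rewrite normcM normcV normc_nat mulrC ler_pdivrMr ?ltr0n//.
apply: le_trans (normc_sum _ _) _.
apply: le_trans (ler_sum _ (fun j _ => supnorm_ub x j)) _.
by rewrite sumr_const_nat subn0 mulr_natr.
Qed.

Lemma supnorm_cesaro_iter n x : supnorm (cesaro_iter n x) <= supnorm x.
Proof. by elim: n => //= n; exact/le_trans/supnorm_cesaroT. Qed.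

(** Each [(j + 1) * cesaro_mean u j] is a partial sum of [u]. Divided by [(k + 1) (k + 2)], the
    identity exhibits [T u] as half a weighted mean of [u + T u]. *)
Lemma weighted_sum_cesaro_mean (u : nat -> R[i]) k :
  \sum_(0 <= j < k.+1) j.+1%:R * (u j + cesaro_mean u j)
  = k.+2%:R * \sum_(0 <= j < k.+1) u j.
Proof.
have mean j : j.+1%:R * cesaro_mean u j = \sum_(0 <= i < j.+1) u i.
  by rewrite mulVKf.
elim: k => [|k IHk].
  by rewrite !big_nat1 mulrDr mean big_nat1; ring.
rewrite big_nat_recr//= IHk mulrDr mean [in RHS]big_nat_recr//=.
rewrite [X in _ + (_ + X)]big_nat_recr//= -[k.+3%:R]natr1.
by rewrite -[k.+2%:R]natr1; ring.
Qed.

(* [2T = S (I + T)] for the weighted mean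
   [(S u)_k = 2 / ((k + 1) (k + 2)) * \sum_(j <= k) (j + 1) u_j],
   which is a contraction. *)
Lemma supnorm_cesaroT_avg v : supnorm (cesaroT v) *+ 2 <= supnorm (v + cesaroT v).
Proof.
rewrite -mulr_natr -ler_pdivlMr ?ltr0n//; apply: supnorm_le => k.
set M := supnorm _.
have : normc (\sum_(0 <= j < k.+1) j.+1%:R * (v j + cesaro_mean v j))
    <= \sum_(0 <= j < k.+1) j.+1%:R * M.
  apply: le_trans (normc_sum _ _) _; apply: ler_sum => j _.
  rewrite normcM normc_nat ler_wpM2l ?ler0n//.
  exact: (supnorm_ub (v + cesaroT v) j).
rewrite weighted_sum_cesaro_mean normcM normc_nat -mulr_suml.
have -> : \sum_(0 <= j < k.+1) j.+1%:R = k.+1%:R * k.+2%:R / 2 :> R.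
  elim: k => [|k IHk]; first by rewrite big_nat1; lra.
  by rewrite big_nat_recr//= IHk -[k.+3%:R]natr1 -[k.+2%:R]natr1; lra.
rewrite [cspace_val _ _]/= /cesaro_mean normcM normcV normc_nat.
rewrite [X in _ -> X <= _]mulrC ler_pdivrMr ?ltr0n// => h.
rewrite -(ler_pM2l (ltr0n R k.+2)); apply: le_trans h _.
by rewrite le_eqVlt; apply/orP; left; apply/eqP; lra.
Qed.

Definition idD_cesaroT v := v + cesaroT v.

Lemma iter_idD_cesaroT n v :
  iter n idD_cesaroT v = \sum_(i < n.+1) cesaro_iter i v *+ 'C(n, i).
Proof.
elim: n => [|n IHn]; first by rewrite big_ord1.
rewrite (sum_binS (fun i => cesaro_iter i v)) iterS IHn /idD_cesaroT.
rewrite raddf_sum -big_split/=; apply: eq_bigr => i _.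
by rewrite raddfMn mulrnDl.
Qed.

Lemma cesaroT_iter_idD n v :
  cesaroT (iter n idD_cesaroT v) = iter n idD_cesaroT (cesaroT v).
Proof. by elim: n => //= n <-; rewrite {1}/idD_cesaroT raddfD. Qed.

(** Each factor [T] is traded for [(I + T) / 2]; since [T] commutes with [I + T], the induction
    hypothesis applies to [T v]. *)
Lemma supnorm_cesaro_iter_avg n v :
  supnorm (cesaro_iter n v) *+ 2 ^ n <= supnorm (iter n idD_cesaroT v).
Proof.
elim: n v => [|n IHn] v //.
rewrite expnSr mulrnA {1}/cesaro_iter iterSr iterS.
apply: le_trans (supnorm_cesaroT_avg _).
by rewrite lerMn2r cesaroT_iter_idD IHn orbT.
Qed.

Lemma supnorm_cesaro_iter_diff n v :
  supnorm (cesaro_iter n (v - cesaroT v)) * Num.sqrt n.+1%:R <= supnorm v *+ 2.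
Proof.
have n0 : 0 < n.+1%:R :> R by rewrite ltr0n.
(* The factor [2^n] allows passing from [T^n] to [(I + T)^n]; the factor [n + 1 = s * s] is the one
   that [sum_bin_diff] requires. *)
rewrite -(ler_pM2r (exprn_gt0 n (ltr0n R 2))) -(ler_pM2r n0).
set s := Num.sqrt _; have ss : s * s = n.+1%:R by rewrite -expr2 sqr_sqrtr// ltW.
have s0 : 0 < s by rewrite sqrtr_gt0.
have := supnorm_cesaro_iter_avg n (v - cesaroT v).
rewrite iter_idD_cesaroT -[X in X <= _]mulr_natr natrX => h.
rewrite -[X in _ * X <= _]ss.
suff h2 : supnorm (\sum_(i < n.+1) cesaro_iter i (v - cesaroT v) *+ 'C(n, i))
    * n.+1%:R <= supnorm v * (s *+ 2 ^ n.+1).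
  have := le_trans (ler_wpM2r (ltW n0) h) h2.
  rewrite -[s *+ _]mulr_natr natrX exprS -ss => h3.
  by have := ler_wpM2r (ltW s0) h3; congr (_ <= _); ring.
have -> : \sum_(i < n.+1) cesaro_iter i (v - cesaroT v) *+ 'C(n, i)
    = \sum_(i < n.+1) (cesaro_iter i v - cesaro_iter i.+1 v) *+ 'C(n, i).
  by apply: eq_bigr => i _; rewrite raddfB [cesaro_iter _.+1 _]iterSr.
rewrite mulr_natr -supnormMn (sum_bin_diff (fun i => cesaro_iter i v)).
apply: le_trans (ler_supnorm_sum _ _) _.
apply: (@le_trans _ _ (\sum_(i < n.+2)
    supnorm v * (`|n.+1%:R - i%:R *+ 2| *+ 'C(n.+1, i)))).
  apply: ler_sum => i _.
  have -> : `|n.+1%:R - i%:R *+ 2 : R| *+ 'C(n.+1, i)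
      = `|((n.+1 - i) * 'C(n.+1, i))%:R - (i * 'C(n.+1, i))%:R|.
    rewrite !natrM -mulrBl normrM normr_nat mulr_natr.
    by rewrite natrB ?mulr2n ?opprD ?addrA// -ltnS.
  rewrite supnorm_distMn ler_wpM2r//.
  exact: supnorm_cesaro_iter.
by rewrite -mulr_sumr ler_wpM2l ?supnorm_ge0// binomial_first_moment.
Qed.

End CesaroPowers.

(** * Decay of products of factors [I - T^N] *)

Section FastDecay.
Variable R : realType.
Implicit Types (x y v w z : cspace R) (m n k N : nat).

Definition cesaro_diff N v := v - cesaro_iter N v.

Definition cesaro_diffs (s : seq nat) v := foldr cesaro_diff v s.

Lemma cesaro_diffB N v w :
  cesaro_diff N (v - w) = cesaro_diff N v - cesaro_diff N w.
Proof. by rewrite /cesaro_diff raddfB/= !opprD !opprK addrACA. Qed.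

Lemma cesaro_diffsB s v w :
  cesaro_diffs s (v - w) = cesaro_diffs s v - cesaro_diffs s w.
Proof. by elim: s => //= N s ->; rewrite cesaro_diffB. Qed.

Lemma cesaro_iter_diff n N v :
  cesaro_iter n (cesaro_diff N v) = cesaro_diff N (cesaro_iter n v).
Proof. by rewrite /cesaro_diff raddfB/= -!cesaro_iterD addnC. Qed.

Lemma supnorm_cesaro_diffs s v :
  supnorm (cesaro_diffs s v) <= supnorm v *+ 2 ^ size s.
Proof.
elim: s => //= N s IHs; apply: le_trans (ler_supnormD _ _) _.
rewrite supnormN expnSr mulrnA mulr2n lerD//.
exact: le_trans (supnorm_cesaro_iter _ _) IHs.
Qed.

(** Telescoping: [I - T^N] is the sum of the [T^j (I - T)] for [j < N], and [T^j] is a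
    contraction. *)
Lemma supnorm_cesaro_iter_cesaro_diff n N v :
  supnorm (cesaro_iter n (cesaro_diff N v)) * Num.sqrt n.+1%:R
  <= supnorm v *+ 2 *+ N.
Proof.
elim: N => [|N IHN].
  by rewrite /cesaro_diff/= subrr raddf0 supnorm0 mul0r.
have -> : cesaro_diff N.+1 v =
    cesaro_diff N v + (cesaro_iter N v - cesaroT (cesaro_iter N v)).
  by rewrite /cesaro_diff addrA subrK.
rewrite raddfD/= [leRHS]mulrSr.
apply: le_trans (ler_wpM2r (sqrtr_ge0 _) (ler_supnormD _ _)) _.
rewrite mulrDl lerD//; apply: le_trans (supnorm_cesaro_iter_diff _ _) _.
by rewrite lerMn2r supnorm_cesaro_iter orbT.
Qed.

(** About half of the [n] iterates act on the new factor and gain one [sqrt]; the other half use the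
    decay of [x]. Replacing [n] by its half costs [2 ^+ m.+1]. *)
Lemma decay_cesaro_diff m N (c : R) x :
  (forall n, supnorm (cesaro_iter n x) * Num.sqrt n.+1%:R ^+ m <= c) ->
  forall n, supnorm (cesaro_iter n (cesaro_diff N x)) * Num.sqrt n.+1%:R ^+ m.+1
    <= c *+ 2 *+ N * 2 ^+ m.+1.
Proof.
move=> xc n; set h := n./2; set s : R := Num.sqrt h.+1%:R.
have s0 : 0 <= s by exact: sqrtr_ge0.
have nE : n = (odd n + (h + h))%N by rewrite addnn odd_double_half.
have le_s : Num.sqrt n.+1%:R <= 2 * s.
  rewrite -[2](ger0_norm (ler0n R 2)) -sqrtr_sqr -sqrtrM ?exprn_ge0//.
  rewrite ler_sqrt ?mulr_ge0// -natrX -natrM ler_nat.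
  by rewrite {1}nE -/h; case: (odd n); lia.
(* For odd [n] the leftover iterate is dropped by contraction. *)
have le_x : supnorm (cesaro_iter n (cesaro_diff N x)) <=
    supnorm (cesaro_iter h (cesaro_diff N (cesaro_iter h x))).
  rewrite {1}nE !cesaro_iterD [cesaro_iter h (cesaro_diff _ _)]cesaro_iter_diff.
  exact: supnorm_cesaro_iter.
apply: le_trans (ler_pM _ _ le_x (lerXn2r m.+1 _ _ le_s)) _; rewrite ?nnegrE.
- exact: supnorm_ge0.
- by rewrite exprn_ge0 ?sqrtr_ge0.
- exact: sqrtr_ge0.
- by rewrite mulr_ge0.
rewrite exprMn mulrCA mulrC ler_wpM2r ?exprn_ge0// exprS mulrA.
have := ler_wpM2r (exprn_ge0 m s0)
  (supnorm_cesaro_iter_cesaro_diff h N (cesaro_iter h x)).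
move=> /le_trans; apply.
by rewrite -!mulrnA mulrnAl lerMn2r xc orbT.
Qed.

(** The constant is uniform on a ball: later, [s] holds the first factors of the infinite product
    while [w] runs through partial products of the others. *)
Lemma decay_cesaro_diffs s (b : R) : exists c : R, forall w, supnorm w <= b ->
  forall n, supnorm (cesaro_iter n (cesaro_diffs s w))
    * Num.sqrt n.+1%:R ^+ size s <= c.
Proof.
elim: s => [|N s [c IHs]]; last first.
  by exists (c *+ 2 *+ N * 2 ^+ (size s).+1) => w /IHs; exact: decay_cesaro_diff.
exists b => w wb n; rewrite expr0 mulr1.
exact: le_trans (supnorm_cesaro_iter _ _) wb.
Qed.

(** * Limits of geometrically Cauchy sequences, and completeness of [c] *)

Lemma exists_half_expr_lt (K e : R) : 0 < e -> exists i, K * 2^-1 ^+ i < e.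
Proof.
move=> e0; set N := Num.bound (`|K| / e); exists N.
have KN : `|K| / e < N%:R by rewrite archi_boundP// divr_ge0// ltW.
rewrite exprVn ltr_pdivrMr ?exprn_gt0// mulrC -ltr_pdivrMr//.
apply: le_lt_trans (lt_trans KN _).
  by rewrite ler_pM2r ?invr_gt0// ler_norm.
by rewrite -natrX ltr_nat ltn_expl.
Qed.

(** Nested intervals: the radius [q i] is the sum of all increment bounds from [i] on, and [l] is
    the supremum of the left endpoints. *)
Lemma half_expr_cauchy_real (a : nat -> R) (K : R) :
  (forall i, `|a i.+1 - a i| <= K * 2^-1 ^+ i) ->
  exists l, forall i, `|l - a i| <= K *+ 2 * 2^-1 ^+ i.
Proof.
move=> aK; set q := fun i => K *+ 2 * 2^-1 ^+ i.
have qS i : q i.+1 = q i - K * 2^-1 ^+ i by rewrite /q exprS; lra.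
have q0 i : 0 <= q i.
  rewrite /q; have := le_trans (normr_ge0 _) (aK i); lra.
have lo : {homo (fun i => a i - q i) : i j / (i <= j)%N >-> i <= j}.
  apply/nondecreasing_seqP => i; rewrite qS.
  by have := aK i; rewrite ler_norml => /andP[]; lra.
have hi : {homo (fun i => - (a i + q i)) : i j / (i <= j)%N >-> i <= j}.
  apply/nondecreasing_seqP => i; rewrite qS.
  by have := aK i; rewrite ler_norml => /andP[]; lra.
have lohi i j : a i - q i <= a j + q j.
  have := lo _ _ (leq_maxl i j); have := hi _ _ (leq_maxr i j).
  have := q0 (maxn i j); rewrite lerN2; lra.
pose l := sup (range (fun i => a i - q i)).
have hs : has_ubound (range (fun i => a i - q i)).
  by exists (a 0%N + q 0%N) => _ [i _ <-].
exists l => i; rewrite ler_norml.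
have : a i - q i <= l by apply: ub_le_sup => //; exists i.
have : l <= a i + q i.
  by apply: ge_sup => [|_ [j _ <-]//]; exists (a 0%N - q 0%N), 0%N.
by rewrite -/(q i); lra.
Qed.

Lemma ler_Re_normc (u : R[i]) : `|complex.Re u| <= normc u.
Proof.
case: u => a b /=; rewrite -sqrtr_sqr ler_sqrt ?addr_ge0 ?sqr_ge0//.
by rewrite lerDl sqr_ge0.
Qed.

Lemma ler_Im_normc (u : R[i]) : `|complex.Im u| <= normc u.
Proof.
case: u => a b /=; rewrite -sqrtr_sqr ler_sqrt ?addr_ge0 ?sqr_ge0//.
by rewrite lerDr sqr_ge0.
Qed.

Lemma ler_normc_ReIm (u : R[i]) :
  normc u <= `|complex.Re u| + `|complex.Im u|.
Proof.
case: u => a b /=; rewrite -[leRHS]ger0_norm ?addr_ge0// -sqrtr_sqr.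
rewrite ler_sqrt ?sqr_ge0// sqrrD !real_normK ?num_real//.
have := mulr_ge0 (normr_ge0 a) (normr_ge0 b); lra.
Qed.

Lemma half_expr_cauchy_complex (u : nat -> R[i]) (K : R) :
  (forall i, normc (u i.+1 - u i) <= K * 2^-1 ^+ i) ->
  exists l, forall i, normc (l - u i) <= K *+ 4 * 2^-1 ^+ i.
Proof.
move=> uK.
have [a ha] : exists a, forall i, `|a - complex.Re (u i)| <= K *+ 2 * 2^-1 ^+ i.
  apply: half_expr_cauchy_real => i; apply: le_trans (uK i).
  by rewrite -raddfB; exact: ler_Re_normc.
have [b hb] : exists b, forall i, `|b - complex.Im (u i)| <= K *+ 2 * 2^-1 ^+ i.
  apply: half_expr_cauchy_real => i; apply: le_trans (uK i).
  by rewrite -raddfB; exact: ler_Im_normc.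
exists (Complex a b) => i; apply: le_trans (ler_normc_ReIm _) _.
rewrite !raddfB/=; have := ha i; have := hb i; lra.
Qed.

Lemma cvg_normcP (u : nat -> R[i]) (l : R[i]) : u @ \oo --> l <->
  forall e : R, 0 < e -> exists N, forall k, (N <= k)%N -> normc (u k - l) < e.
Proof.
have normr_normc k : `|0 - normc (u k - l)| = normc (u k - l).
  by rewrite sub0r normrN ger0_norm// normc_ge0.
split=> [/cvg_normc/cvgrPdist_lt ul e /ul[N _ uN]|ul].
  by exists N => k /uN/=; rewrite normr_normc.
apply/cvg_normc/cvgrPdist_lt => e /ul[N uN].
by exists N => // k /uN; rewrite /= normr_normc.
Qed.

Lemma normcN (u : R[i]) : normc (- u) = normc u.
Proof. by apply: complexI; rewrite -!Defs.normcE normrN. Qed.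

(** The limit is taken coordinatewise. To see that it lies in [c], the limits [lx i] of the
    sequences [x i] are shown to be geometrically Cauchy too; their limit [l] is the limit of
    [z]. *)
Lemma half_expr_cauchy_cspace (x : nat -> cspace R) (K : R) :
  (forall i, supnorm (x i.+1 - x i) <= K * 2^-1 ^+ i) ->
  exists z, forall i, supnorm (z - x i) <= K *+ 4 * 2^-1 ^+ i.
Proof.
move=> xK.
have ptK k i : normc (x i.+1 k - x i k) <= K * 2^-1 ^+ i.
  exact: le_trans (supnorm_ub (x i.+1 - x i) k) (xK i).
have /choice[z zx] k :
    exists l, forall i, normc (l - x i k) <= K *+ 4 * 2^-1 ^+ i.
  exact: half_expr_cauchy_complex.
have /choice[lx xlx] i : exists l : R[i], (x i : nat -> R[i]) @ \oo --> l.
  exact/cvg_ex/cspace_cvg.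
have [l lxl] : exists l, forall i, normc (l - lx i) <= K *+ 4 * 2^-1 ^+ i.
  apply: half_expr_cauchy_complex => i; apply/ler_addgt0Pr => e e0.
  have e20 : 0 < e / 2 by rewrite divr_gt0.
  have /cvg_normcP/(_ _ e20)[N1 h1] := xlx i.
  have /cvg_normcP/(_ _ e20)[N2 h2] := xlx i.+1.
  have {}h1 := h1 _ (leq_addr N2 N1); have {}h2 := h2 _ (leq_addl N1 N2).
  set k := (N1 + N2)%N in h1 h2.
  have -> : lx i.+1 - lx i =
      (x i.+1 k - x i k) + ((x i k - lx i) - (x i.+1 k - lx i.+1)) by ring.
  apply: le_trans (Defs.normcD _ _) _; apply: lerD (ptK _ _) _.
  by apply: le_trans (Defs.normcD _ _) _; rewrite normcN; lra.
have cz : z \in @convergent R.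
  apply/convergentP/cvg_ex; exists l; apply/cvg_normcP => e e0.
  have e20 : 0 < e / 2 by rewrite divr_gt0.
  (* Two errors of size [K *+ 4 * 2^-1 ^+ i]: from [z k] to [x i k], and from [lx i] to [l]. *)
  have [i hi] := exists_half_expr_lt (K *+ 8) e20.
  have /cvg_normcP/(_ _ e20)[N hN] := xlx i.
  exists N => k /hN {}hN.
  have -> : z k - l = (z k - x i k) + ((x i k - lx i) + - (l - lx i)) by ring.
  apply: le_lt_trans (Defs.normcD _ _) _.
  have h3 := Defs.normcD (x i k - lx i) (- (l - lx i)).
  rewrite normcN in h3; have := zx k i; have := lxl i; lra.
exists (CSpace cz) => i; apply: supnorm_le => k; exact: zx.
Qed.

(** [z] is the infinite product applied to [y]. For each [m], its first [m] factors give the decay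
    of order [m], while the remaining ones only move [y] within a fixed ball. *)
Lemma cesaro_fast_decay_dense y (eps : R) : 0 < eps ->
  (forall e : R, 0 < e -> exists N, supnorm (cesaro_iter N y) <= e) ->
  exists z, supnorm (z - y) <= eps /\
    forall m, exists c : R, forall n,
      supnorm (cesaro_iter n z) * Num.sqrt n.+1%:R ^+ m <= c.
Proof.
move=> eps0 y0; pose K := eps / 4.
have K0 : 0 < K by rewrite divr_gt0.
(* One factor [2^-1 ^+ j] offsets the norm bound [2 ^ i] of the preceding factors; the other makes
   the increments summable. *)
have /choice[N hN] j :
    exists N, supnorm (cesaro_iter N y) <= K * (2^-1 ^+ j * 2^-1 ^+ j).
  by apply: y0; rewrite !mulr_gt0 ?exprn_gt0// invr_gt0.
(* The partial product over [N m], ..., [N (m + i - 1)]: [X 0] converges to [z], and [X m] is what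
   follows the first [m] factors. *)
pose X m i := cesaro_diffs [seq N j | j <- iota m i] y.
have XS m i : supnorm (X m i.+1 - X m i) <= K * 2^-1 ^+ i.
  rewrite /X -addn1 iotaD map_cat /cesaro_diffs foldr_cat/=.
  rewrite -!/(cesaro_diffs _ _) -cesaro_diffsB /cesaro_diff addrC addKr.
  apply: le_trans (supnorm_cesaro_diffs _ _) _.
  rewrite size_map size_iota supnormN -[leLHS]mulr_natr natrX.
  rewrite -ler_pdivlMr ?exprn_gt0// -exprVn -mulrA.
  apply: le_trans (hN _) _; apply: ler_wpM2l; first exact: ltW.
  by rewrite ler_pM ?exprn_ge0 ?invr_ge0// ler_wiXn2l ?leq_addl ?invr_ge0//
    invf_le1 ?ler1n.
have X0 m : X m 0%N = y by [].
have Xy m i : supnorm (X m i - y) <= K *+ 2 * (1 - 2^-1 ^+ i).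
  elim: i => [|i IHi]; first by rewrite X0 subrr supnorm0 expr0 subrr mulr0.
  rewrite -[X m i.+1](subrK (X m i)) -addrA.
  apply: le_trans (ler_supnormD _ _) _.
  by have := XS m i; rewrite exprS; lra.
have [z zX] := half_expr_cauchy_cspace (XS 0%N).
exists z; split.
  by have := zX 0%N; rewrite X0 expr0 /K; lra.
move=> m; have [c hc] := decay_cesaro_diffs [seq N j | j <- iota 0 m] (supnorm y + eps).
exists (c + 1) => n; set q := Num.sqrt _ ^+ m.
have q0 : 0 <= q by rewrite exprn_ge0 ?sqrtr_ge0.
(* The index [i] depends on [n]: replacing [z] by [X 0 (m + i)] then costs less than [1] after
   multiplication by [q], whence [c + 1]. *)
have [i hi] := exists_half_expr_lt (K *+ 4 * q) (@ltr01 R).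
have XE : X 0%N (m + i)%N = cesaro_diffs [seq N j | j <- iota 0 m] (X m i).
  by rewrite /X iotaD map_cat /cesaro_diffs foldr_cat.
have {}hc : supnorm (cesaro_iter n (X 0%N (m + i)%N)) * q <= c.
  have := hc (X m i); rewrite -XE size_map size_iota; apply.
  rewrite -[X m i](subrK y) addrC; apply: le_trans (ler_supnormD _ _) _.
  rewrite lerD2l; apply: le_trans (Xy _ _) _.
  have : 0 <= 2^-1 ^+ i :> R by rewrite exprn_ge0 ?invr_ge0.
  by move=> i0; have := mulr_ge0 (ltW K0) i0; rewrite /K; lra.
rewrite -[z](subrK (X 0%N (m + i)%N)) raddfD/= addrC.
apply: le_trans (ler_wpM2r q0 (ler_supnormD _ _)) _.
rewrite mulrDl lerD//; apply: ltW; apply: le_lt_trans hi.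
rewrite mulrAC ler_wpM2r//.
apply: le_trans (supnorm_cesaro_iter _ _) _; apply: le_trans (zX _) _.
rewrite ler_pM2l ?mulrn_wgt0// ler_wiXn2l ?leq_addl ?invr_ge0//.
by rewrite invf_le1 ?ler1n.
Qed.

End FastDecay.

(** * Limits of [T^n x], and the sets [cesaroX] and [cesaroXinf] *)

Section CesaroLimits.
Variable R : realType.
Implicit Types (x y z : cspace R) (m n k N : nat).

Lemma cvg_supnormP (u : nat -> cspace R) (l : cspace R) : u @ \oo --> l <->
  forall e : R, 0 < e -> exists N, forall n, (N <= n)%N -> supnorm (u n - l) < e.
Proof.
split=> [/cvgrPdist_lt ul e e0|ul].
  have /ul[N _ uN] : (0 : R[i]) < e%:C%C by rewrite ltcR.
  by exists N => n /uN/=; rewrite distrC cspace_normE ltcR.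
apply/cvgrPdist_lt => -[e e'] /=; rewrite ltcE/= => /andP[/eqP -> /ul[N uN]].
by exists N => // n /uN /=; rewrite distrC cspace_normE ltcR.
Qed.

(** Strong induction: at index [k + 1] the equation reads
    [(k + 2) x_(k+1) = (k + 1) x_0 + x_(k+1)]. *)
Lemma cesaroT_fixed x : cesaroT x = x -> x = cesaroP x.
Proof.
move=> Tx; apply/val_inj/funext => k /=.
rewrite -[RHS]/(x 0%N * 1) mulr1; elim/ltn_ind: k => -[//|k] IHk.
have := congr1 (fun y : cspace R => k.+2%:R * y k.+1) Tx.
rewrite /= /cesaro_mean mulVKf// big_nat_recr//=.
rewrite (eq_big_nat _ _ (F2 := fun=> x 0%N)); last first.
  by move=> j /andP[_]; exact: IHk.
rewrite sumr_const_nat subn0 -[k.+2%:R]natr1 mulrDl mul1r => /addIr.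
move=> eq_k; apply: (@mulfI _ k.+1%:R); first by rewrite pnatr_eq0.
by rewrite -eq_k mulr_natl.
Qed.

Lemma cesaro_iter0 n x : cesaro_iter n x 0%N = x 0%N.
Proof.
by elim: n => //= n <-; rewrite /cesaro_mean big_nat1 invr1 mul1r.
Qed.

Lemma cesaro_iterP n x : cesaro_iter n (cesaroP x) = cesaroP x.
Proof.
elim: n => //= n ->; apply/val_inj/funext => k.
by rewrite /= /cesaro_mean sumr_const_nat subn0 -[X in _ * X = _]mulr_natl mulKf.
Qed.

Lemma cesaroP_linear : linear (@cesaroP R).
Proof.
by move=> a x y; rewrite /cesaroP -[(a *: x + y) 0%N]/(a * x 0%N + y 0%N)
  scalerDl scalerA.
Qed.

(** By continuity the limit is a fixed point of [T], hence constant; its value is [x 0] because [T]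
    preserves the coordinate [0]. *)
Lemma cesaroX_cvg x : cesaroX x ->
  (fun n => cesaro_iter n x) @ \oo --> cesaroP x.
Proof.
move=> /cvg_ex[l Tl]; suff -> : cesaroP x = l by [].
have {}Tl := (cvg_supnormP _ _).1 Tl.
have supnorm_eq0 y z : (forall e : R, 0 < e -> supnorm (y - z) < e) -> y = z.
  move=> yz; apply/eqP; rewrite -subr_eq0; apply/eqP/supnorm0_eq0; congr (_%:C%C).
  apply/le_anti; rewrite supnorm_ge0 andbT; apply/ler_addgt0Pr => e /yz.
  by rewrite add0r => /ltW.
have lfix : cesaroT l = l.
  apply: supnorm_eq0 => e e0.
  have [N TN] := Tl _ (divr_gt0 e0 (ltr0n R 2)).
  have -> : cesaroT l - l =
      cesaroT (- (cesaro_iter N x - l)) + (cesaro_iter N.+1 x - l).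
    by rewrite opprB raddfB/= addrA subrK.
  apply: le_lt_trans (ler_supnormD _ _) _.
  have := supnorm_cesaroT (- (cesaro_iter N x - l)); rewrite supnormN.
  by have := TN N (leqnn _); have := TN N.+1 (leqnSn _); rewrite /cesaro_iter; lra.
rewrite (cesaroT_fixed lfix) /cesaroP; congr (_ *: _).
apply/eqP; rewrite -subr_eq0; apply/eqP/eq0_normc/le_anti.
rewrite normc_ge0 andbT; apply/ler_addgt0Pr => e /Tl[N /(_ _ (leqnn N)) TN].
rewrite add0r; apply: le_trans (ltW TN).
by have := supnorm_ub (cesaro_iter N x - l) 0%N; rewrite -(cesaro_iter0 N x).
Qed.

(** A real-valued form of the big-O condition. Conversely, the bound at [r = 1] yields membership in
    [cesaroX]. *)
Lemma cesaroXinfP x : cesaroXinf x <-> forall r : R, 0 < r -> exists c : R,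
  \forall n \near \oo,
    supnorm (cesaro_iter n x - cesaroP x) <= c * n%:R `^ (- r).
Proof.
split=> [[_ xO] r /xO/eqO_exP[k k0 xk]|xO].
  exists (complex.Re k); apply: filterS xk => n.
  case: k k0 => a b; rewrite ltcE/= => /andP[/eqP -> _].
  rewrite cspace_normE Defs.normcE -[Complex a 0]/(a%:C%C) -rmorphM lecR.
  suff -> : normc (n%:R `^ (- r))%:C%C = n%:R `^ (- r) by [].
  by rewrite /= expr0n/= addr0 sqrtr_sqr ger0_norm ?powR_ge0.
split.
  apply/cvg_ex; exists (cesaroP x); apply/cvg_supnormP => e e0.
  have [c [N _ hN]] := xO _ ltr01.
  set M := Num.bound (`|c| / e); exists (N + M.+1)%N => n Nn.
  apply: le_lt_trans (hN n _) _; first exact: leq_trans (leq_addr _ _) Nn.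
  have n0 : (0 < n)%N by apply: leq_trans Nn; rewrite addnS.
  rewrite powR_inv1// ltr_pdivrMr ?ltr0n// mulrC -ltr_pdivrMr//.
  apply: le_lt_trans (_ : `|c| / e < _); first by rewrite ler_pM2r ?invr_gt0// ler_norm.
  apply: lt_le_trans (archi_boundP _) _; first by rewrite divr_ge0// ltW.
  by rewrite ler_nat; apply: leq_trans Nn; rewrite -/M addnS ltnW// ltnS leq_addl.
(* The maximum with [1] ensures a positive constant. *)
move=> r /xO[c xc]; apply/eqO_exP; exists (Num.max c 1)%:C%C.
  by rewrite ltcR lt_max ltr01 orbT.
apply: filterS xc => n xc.
rewrite cspace_normE Defs.normcE -rmorphM lecR.
have -> : normc (n%:R `^ (- r))%:C%C = n%:R `^ (- r).
  by rewrite /= expr0n/= addr0 sqrtr_sqr ger0_norm ?powR_ge0.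
by apply: le_trans xc _; rewrite ler_wpM2r ?powR_ge0// le_max lexx.
Qed.

Lemma cesaroXinf_submod : GRing.submod_closed [in @cesaroXinf R].
Proof.
split=> [|a x y].
  rewrite inE; apply/cesaroXinfP => r r0; exists 0; apply: nearW => n.
  by rewrite raddf0 /cesaroP scale0r subr0 supnorm0 mul0r.
move=> /set_mem/cesaroXinfP xr /set_mem/cesaroXinfP yr.
apply/mem_set/cesaroXinfP => r r0.
have [c xc] := xr _ r0; have [d yd] := yr _ r0.
exists (normc a * c + d); near=> n.
have xn : supnorm (cesaro_iter n x - cesaroP x) <= c * n%:R `^ (- r) by near: n.
have yn : supnorm (cesaro_iter n y - cesaroP y) <= d * n%:R `^ (- r) by near: n.
have -> : cesaro_iter n (a *: x + y) - cesaroP (a *: x + y) =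
    a *: (cesaro_iter n x - cesaroP x) + (cesaro_iter n y - cesaroP y).
  by rewrite linearP cesaroP_linear scalerBr opprD addrACA.
apply: le_trans (ler_supnormD _ _) _; rewrite mulrDl lerD//.
have -> : supnorm (a *: (cesaro_iter n x - cesaroP x)) =
    normc a * supnorm (cesaro_iter n x - cesaroP x).
  by apply: complexI; rewrite supnormZ Defs.normcE rmorphM.
by rewrite -mulrA ler_wpM2l ?normc_ge0.
Unshelve. all: by end_near. Qed.

Lemma cesaroXinf_fast_decay x y : y 0%N = 0 ->
  (forall m, exists c : R, forall n,
     supnorm (cesaro_iter n y) * Num.sqrt n.+1%:R ^+ m <= c) ->
  cesaroXinf (cesaroP x + y).
Proof.
move=> y0 yc; apply/cesaroXinfP => r r0.
(* With [m > 2 r], the power [sqrt (n + 1) ^ m] dominates [n^r]. *)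
pose m := Num.bound (r *+ 2); have [c hc] := yc m; exists c.
exists 1%N => // n /= n0.
have Px : cesaroP (cesaroP x + y) = cesaroP x.
  congr (_ *: _); rewrite -[LHS]/(x 0%N * 1 + y 0%N).
  by rewrite y0 mulr1 addr0.
rewrite raddfD/= cesaro_iterP Px [_ + cesaro_iter _ _]addrC addrK.
rewrite powRN ler_pdivlMr ?powR_gt0 ?ltr0n//; apply: le_trans (hc n).
rewrite ler_wpM2l ?supnorm_ge0//.
rewrite -powR12_sqrt// -powR_mulrn ?powR_ge0// -powRrM.
apply: (@le_trans _ _ (n.+1%:R `^ r)).
  by apply: ge0_ler_powR; rewrite ?nnegrE ?ler0n ?ler_nat// ltW.
rewrite ler_powR ?ler1n//.
have := archi_boundP (mulrn_wge0 2 (ltW r0)); rewrite -/m; lra.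
Qed.

(** The approximation applies to [x - P x], whose iterates tend to [0]; adding [P x] back to [z]
    approximates [x]. *)
Lemma cesaroXinf_dense : @cesaroX R `<=` closure (@cesaroXinf R).
Proof.
move=> x Xx B /nbhs_ballP[e e0 xeB].
have Tx := (cvg_supnormP _ _).1 (cesaroX_cvg Xx).
have [d d0 dE] : exists2 d : R, 0 < d & e = d%:C%C.
  by case: e e0 {xeB} => a b /=; rewrite ltcE/= => /andP[/eqP -> a0]; exists a.
have d20 : 0 < d / 2 by rewrite divr_gt0.
have [|z [zx zc]] := cesaro_fast_decay_dense (y := x - cesaroP x) d20.
  move=> e' /Tx[N /(_ _ (leqnn N)) TN]; exists N.
  by rewrite raddfB/= cesaro_iterP ltW.
(* [T] preserves the coordinate [0], so the decay of [T^n z] at rate [1 / (n + 1)], the case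
   [m = 2], forces it to vanish. *)
have z0 : z 0%N = 0.
  apply/eq0_normc/le_anti; rewrite normc_ge0 andbT; apply/ler_addgt0Pr => h h0.
  have [c hc] := zc 2%N.
  set M := Num.bound (`|c| / h); have := hc M; rewrite sqr_sqrtr// => hM.
  rewrite add0r -(cesaro_iter0 M z); apply: le_trans (supnorm_ub _ _) _.
  rewrite -(ler_pM2r (ltr0n R M.+1)); apply: le_trans hM _.
  rewrite mulrC -ler_pdivrMr//; apply: le_trans (_ : `|c| / h <= _).
    by rewrite ler_pM2r ?invr_gt0// ler_norm.
  apply: le_trans (ltW (archi_boundP _)) _; first by rewrite divr_ge0// ltW.
  by rewrite ler_nat.
exists (cesaroP x + z); split; first exact: cesaroXinf_fast_decay.
apply: xeB; rewrite -ball_normE/= distrC dE cspace_normE ltcR.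
have -> : cesaroP x + z - x = z - (x - cesaroP x) by rewrite opprB addrCA addrA.
by apply: le_lt_trans zx _; lra.
Qed.

End CesaroLimits.

Theorem proposition3p12 (R : realType) :
  [/\ GRing.submod_closed [in @cesaroXinf R],
      @cesaroXinf R `<=` @cesaroX R
    & @cesaroX R `<=` closure (@cesaroXinf R)].
Proof.
by split; [exact: cesaroXinf_submod | move=> x [] | exact: cesaroXinf_dense].
Qed.
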